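(* Let $f:\mathbb{R}^n\to\mathbb{R}^n$ be the polynomial mapping $f=(p_1,\ldots,p_n)$ with $p_1,\ldots,p_n\in\mathbb{R}[X_1,\ldots,X_n]$. Suppose that the Jacobian determinant $\det J(f)(X_1,\ldots,X_n)$ never vanishes on $\mathbb{R}^n$. If there are positive even integers $\alpha_1,\ldots,\alpha_n$ such that the homogeneous system $$\overline{\sum_{j=1}^n\alpha_j\,p_j^{\alpha_j-1}\,\frac{\partial p_j}{\partial X_i}}=0,\qquad i=1,\ldots,n,$$ has only the zero solution over $\mathbb{R}$, then $f(\mathbb{R}^n)=\mathbb{R}^n$.
   Context: For a polynomial $p\in\mathbb{R}[X_1,\ldots,X_n]$, $\overline{p}$ denotes the leading (highest degree) homogeneous component of $p$ with respect to the standard grading $\deg X_j=1$ for $1\le j\le n$; $\overline{0}=0$. In the displayed system the bar is applied to the whole polynomial $\sum_{j=1}^n\alpha_j p_j^{\alpha_j-1}\,\partial p_j/\partial X_i$ for each $i$. $J(f)$ is the Jacobian matrix of the first order partial derivatives $\partial p_j/\partial X_i$, $i,j=1,\ldots,n$. *)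

(* Defs.v *)
From HB Require Import structures.
From mathcomp Require Import all_boot all_order all_algebra.
From mathcomp Require Import mpoly.

Set Implicit Arguments.
Unset Strict Implicit.
Unset Printing Implicit Defensive.

Import GRing.Theory.
Local Open Scope ring_scope.

Section PolynomialMaps.
Variables (n : nat) (R : comNzRingType).
Implicit Types (q : {mpoly R[n]}) (p : 'I_n -> {mpoly R[n]}).

(* The evaluation point is a row vector, while meval takes a function. *)
Definition mpeval q (x : 'rV[R]_n) : R := q.@[fun i => x 0 i].

(* msize q is 1 + deg q for q != 0, and msize 0 = 0; hence lead_form 0 = 0. *)
Definition lead_form q : {mpoly R[n]} := pihomog mdeg (msize q).-1 q.

Definition polymap p (x : 'rV[R]_n) : 'rV[R]_n := \row_j mpeval (p j) x.

(* Rows are indexed by the variables and columns by the components, as for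
   the Jacobian of a map acting on row vectors. *)
Definition jacobian_mx p : 'M[{mpoly R[n]}]_n := \matrix_(i, j) mderiv i (p j).

End PolynomialMaps.

(* Main.v *)
Require Import Defs.
From HB Require Import structures.
From mathcomp Require Import all_boot all_order all_algebra.
From mathcomp Require Import classical_sets reals.
From mathcomp Require Import boolp topology normedtype derive.
From mathcomp Require Import ring lra.
From mathcomp Require Import -(notations) mpoly.

(** The function [g = \sum_j p_j ^ alpha_j] is a nonnegative polynomial, because
    the exponents are even, and its partial derivatives are the polynomials
    whose leading forms have no common zero on the unit sphere.

    - Far from the origin a polynomial is governed by its leading form.  By
      compactness of the sphere the gradient of [g] therefore stays away from
      [0] outside a ball ([lead_forms_bounded_preimage]).

    - A function that is bounded below and has this property tends to infinity
      ([coercive_of_gradient]).  For a point [a] with [g a <= C], minimise the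
      penalised function [g z + eps * \sum_j (z_j - a_j) ^ 2]: the minimiser [w]
      is at a bounded distance from [a], and the critical point equation makes
      the gradient of [g] at [w] small when [eps] is, so that [w] lies in the
      fixed ball.  This is Ekeland's variational principle in the smooth and
      locally compact case.

    - If [f] is bounded on a set then so is [g]; hence that set is bounded, and
      for each target [y] the polynomial [Q x = \sum_j (p_j x - y_j) ^ 2] attains
      its minimum ([mpeval_attains_min]).  At a minimiser [w] the equation
      [grad Q w = 0] reads [J(w) (f w - y) = 0]; as [det J(w)] is nonzero,
      [f w = y].

    Minimising [Q] takes the place of the usual topological argument, in which a
    proper local homeomorphism has an open and closed image. *)

Import Order.TTheory GRing.Theory Num.Def Num.Theory numFieldNormedType.Exports.

Local Open Scope ring_scope.
Local Open Scope classical_set_scope.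

(** * Evaluation and derivatives of polynomials *)

(** Induction along the generators of the polynomial algebra: properties stable
    under sums and products, such as continuity and the chain rule below, then
    need no computation with monomials. *)
Lemma mpoly_alg_ind (n : nat) (R : nzRingType) (P : mpoly n R -> Prop) :
    (forall c, P (mpolyC n c)) -> (forall i, P (mpolyX R (mnm1 i))) ->
    (forall q s, P q -> P s -> P (q + s)) ->
    (forall q s, P q -> P s -> P (q * s)) ->
  forall q, P q.
Proof.
move=> PC PX PD PM; elim/mpolyind => [|c m q _ _ Pq].
  by rewrite -mpolyC0; apply: PC.
apply: PD => //; rewrite -mul_mpolyC; apply: (PM) => //.
rewrite mpolyXE_id; elim/big_ind: _ => [|*|i _]; [by rewrite -mpolyC1|exact: PM|].
elim: (m i) => [|k IHk]; first by rewrite expr0 -mpolyC1.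
by rewrite exprS; apply: PM.
Qed.

Section Evaluation.
Set Implicit Arguments.
Unset Strict Implicit.
Variables (n : nat) (R : comNzRingType).
Implicit Types (x : 'rV[R]_n) (q s : mpoly n R).

Lemma mpevalD q s x : mpeval (q + s) x = mpeval q x + mpeval s x.
Proof. exact: mevalD. Qed.

Lemma mpevalB q s x : mpeval (q - s) x = mpeval q x - mpeval s x.
Proof. exact: mevalB. Qed.

Lemma mpevalM q s x : mpeval (q * s) x = mpeval q x * mpeval s x.
Proof. exact: mevalM. Qed.

Lemma mpevalC c x : mpeval (mpolyC n c) x = c.
Proof. exact: mevalC. Qed.

Lemma mpevalXU i x : mpeval (mpolyX R (mnm1 i)) x = x 0 i.
Proof. exact: mevalXU. Qed.

Lemma mpevalX k q x : mpeval (q ^+ k) x = mpeval q x ^+ k.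
Proof. exact: (rmorphXn (meval _)). Qed.

Lemma mpeval_nat k x : mpeval (k%:R : mpoly n R) x = k%:R.
Proof. exact: (rmorph_nat (meval _)). Qed.

Lemma mpeval_sum (I : Type) (r : seq I) (P : pred I) (F : I -> mpoly n R) x :
  mpeval (\sum_(i <- r | P i) F i) x = \sum_(i <- r | P i) mpeval (F i) x.
Proof. exact: (rmorph_sum (meval _)). Qed.

Lemma mpeval_pihomogZ d q (r : R) x :
  mpeval (pihomog mdeg d q) (r *: x) = r ^+ d * mpeval (pihomog mdeg d q) x.
Proof.
rewrite pihomogE !mpeval_sum mulr_sumr; apply: eq_bigr => m /eqP <-.
rewrite /mpeval !mevalZ !mevalX mulrCA; congr (_ * _).
rewrite -[X in r ^+ X]/(mdeg m) mdegE.
rewrite (big_morph (fun k => r ^+ k) (exprD r) (expr0 r)) -big_split /=.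
by apply: eq_bigr => i _; rewrite mxE exprMn.
Qed.

Lemma mderiv_exp i q k :
  mderiv i (q ^+ k) = k%:R * q ^+ k.-1 * mderiv i q.
Proof.
elim: k => [|k IHk]; first by rewrite expr0 -mpolyC1 mderivC !mul0r.
rewrite exprS mderivM IHk; case: k {IHk} => [|k] /=; first by rewrite expr0; ring.
by rewrite exprS -[k.+2%:R]natr1; ring.
Qed.

Lemma mderivXU (i j : 'I_n) : mderiv i (mpolyX R (mnm1 j)) = (j == i)%:R.
Proof.
rewrite mderivX mnm1E; case: eqP => [->|_]; last by rewrite scale0r.
suff -> : mnm_sub (mnm1 i) (mnm1 i) = mnm0 :> multinom n by rewrite mpolyX0 scale1r.
by apply/mnmP => k; rewrite mnmBE mnm0E subnn.
Qed.

Lemma mderiv_sum i (I : Type) (r : seq I) (P : pred I) (F : I -> mpoly n R) :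
  mderiv i (\sum_(j <- r | P j) F j) = \sum_(j <- r | P j) mderiv i (F j).
Proof. exact: raddf_sum. Qed.

End Evaluation.

(** * Polynomial functions on real space *)

Section RealPolynomials.
Set Implicit Arguments.
Unset Strict Implicit.
Variables (R : realType) (n : nat).
Implicit Types (x y z : 'rV[R]_n) (q : mpoly n R).

Lemma coord_le_norm x i : `|x 0 i| <= `|x|.
Proof.
by rewrite [leRHS]/normr /= mx_normrE; apply/bigmax_geP; right => /=; exists (0, i).
Qed.

Lemma norm_le_coord x (K : R) : 0 <= K -> (forall i, `|x 0 i| <= K) -> `|x| <= K.
Proof.
move=> K0 hx; rewrite [leLHS]/normr /= mx_normrE; apply/bigmax_leP; split => //.
by move=> [j i] _ /=; rewrite ord1.
Qed.

Lemma mpeval_continuous q : continuous (mpeval q).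
Proof.
elim/mpoly_alg_ind: q => [c|i|q s cq cs|q s cq cs] x.
- by under [X in continuous_at _ X]funext do rewrite mpevalC; exact: cst_continuous.
- under [X in continuous_at _ X]funext do rewrite mpevalXU.
  exact: coord_continuous.
- under [X in continuous_at _ X]funext do rewrite mpevalD.
  exact: continuousD (cq x) (cs x).
- under [X in continuous_at _ X]funext do rewrite mpevalM.
  exact: continuousM (cq x) (cs x).
Qed.

Lemma mpeval_is_derive q x (i : 'I_n) (t : R) :
  is_derive t (1 : R) (fun s : R => mpeval q (x + s *: delta_mx 0 i))
    (mpeval (mderiv i q) (x + t *: delta_mx 0 i)).
Proof.
elim/mpoly_alg_ind: q => [c|j|q s dq ds|q s dq ds].
- under [X in is_derive _ _ X _]funext do rewrite mpevalC.
  by rewrite mderivC -mpolyC0 mpevalC; exact: is_derive_cst.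
- under [X in is_derive _ _ X _]funext do rewrite mpevalXU !mxE eqxx /=.
  rewrite mderivXU mpeval_nat.
  have dlin := is_deriveD (is_derive_cst (x 0 j) t 1)
    (is_deriveM (is_derive_id t 1) (is_derive_cst ((j == i)%:R : R) t 1)).
  by apply: is_derive_eq dlin _; rewrite /GRing.scale /= mulr0 mulr1 !add0r.
- under [X in is_derive _ _ X _]funext do rewrite mpevalD.
  by rewrite mderivD mpevalD; exact: is_deriveD.
- under [X in is_derive _ _ X _]funext do rewrite mpevalM.
  rewrite mderivM mpevalD !mpevalM; apply: is_derive_eq (is_deriveM dq ds) _.
  by rewrite /GRing.scale /= addrC mulrC.
Qed.

(** Fermat's rule, applied along the coordinate line through [x]. *)
Lemma critical_of_min q x i :
  (forall z, mpeval q x <= mpeval q z) -> mpeval (mderiv i q) x = 0.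
Proof.
move=> xmin.
pose h (s : R) := mpeval q (x + s *: delta_mx 0 i).
have h0 : is_derive (0 : R) (1 : R) h 0.
  apply: (@derive1_at_min _ h (-1) 1 0); first lra.
  - by move=> t _; have [] := mpeval_is_derive q x i t.
  - by rewrite in_itv /=; apply/andP; split; lra.
  - by move=> t _; rewrite /h scale0r addr0.
have := mpeval_is_derive q x i 0; rewrite scale0r addr0 => h1.
by rewrite -(@derive_val _ _ _ _ _ _ _ h1) (@derive_val _ _ _ _ _ _ _ h0).
Qed.

(** The hypothesis confines one nonempty sublevel set to a ball; a minimum over
    the compact ball is then a global one. *)
Lemma mpeval_attains_min q x0 (B : R) :
    (forall x, mpeval q x <= mpeval q x0 -> `|x| <= B) ->
  exists x, forall z, mpeval q x <= mpeval q z.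
Proof.
move=> hB.
pose A := [set x : 'rV[R]_n | `|x| <= B].
have cA : compact A.
  apply: bounded_closed_compact.
    exists B; split; first exact: num_real.
    by move=> M BM x /= xB; exact: le_trans xB (ltW BM).
  apply: (@preimage_closed _ _ (fun x : 'rV[R]_n => `|x|) [set r | r <= B]).
    by move=> x _; exact: norm_continuous.
  exact: closed_le.
have A0 : A x0 by apply: hB.
have [|x _ xmin] := EVT_min_rV (ex_intro _ _ A0) cA (f := mpeval q).
  by apply: continuous_subspaceT => z; exact: mpeval_continuous.
exists x => z; have [zx0|x0z] := leP (mpeval q z) (mpeval q x0).
  by apply: xmin; rewrite inE; exact: hB.
by apply: (le_trans _ (ltW x0z)); apply: xmin; rewrite inE.
Qed.

Lemma monomial_bound (m : multinom n) x :
  `|\prod_i (x 0 i) ^+ (m i)| <= `|x| ^+ mdeg m.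
Proof.
rewrite normr_prod mdegE (big_morph (fun k => `|x| ^+ k) (exprD _) (expr0 _)).
apply: ler_prod => i _; rewrite normr_ge0 normrX /=.
by apply: lerXn2r; rewrite ?nnegrE ?normr_ge0 ?coord_le_norm.
Qed.

(** The monomials outside the leading form have degree at most [d], where
    [d + 1] is the degree of [q]. *)
Lemma lead_form_approx q d : msize q = d.+2 ->
  exists2 M, 0 <= M & forall x, 1 <= `|x| ->
    `|mpeval q x - mpeval (lead_form q) x| <= M * `|x| ^+ d.
Proof.
move=> sq; exists (\sum_(m <- msupp q | mdeg m != d.+1) `|mcoeff m q|).
  by apply: sumr_ge0.
move=> x x1; rewrite /lead_form sq /= pihomogE mpeval_sum /mpeval mevalE.
rewrite (bigID (fun m => mdeg m == d.+1)) /=.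
under [X in _ - X]eq_bigr do rewrite mevalZ mevalX.
rewrite addrC addrK mulr_suml; apply: (le_trans (ler_norm_sum _ _ _)).
rewrite big_seq_cond [leRHS]big_seq_cond; apply: ler_sum => m /andP[mq md].
rewrite normrM ler_wpM2l ?normr_ge0 //; apply: (le_trans (monomial_bound m x)).
apply: ler_weXn2l => //.
by have := msize_mdeg_lt mq; rewrite sq !ltnS leq_eqVlt (negPf md) /= ltnS.
Qed.

(** Where all [q i] are smaller than [1] in absolute value, the leading forms at
    the unit vector [x / |x|] are [O(1 / |x|)]; on the compact sphere they have
    no common zero, hence the sum of their squares has a positive minimum and
    [|x|] is bounded.  This breaks down if some [q i] is a nonzero constant, but
    then [delta := |q i|] makes the condition on [x] unsatisfiable. *)
Lemma lead_forms_bounded_preimage (k : nat) (q : 'I_k -> mpoly n R) :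
    (forall x, (forall i, mpeval (lead_form (q i)) x = 0) -> x = 0) ->
  exists2 delta, 0 < delta & exists B, forall x,
    (forall i, `|mpeval (q i) x| < delta) -> `|x| <= B.
Proof.
move=> q0.
have [[i /msize_poly1P[c c0 qi]]|nconst] :=
    pselect (exists i, msize (q i) == 1%N).
  exists `|c|; first by rewrite normr_gt0.
  by exists 0 => x /(_ i); rewrite qi mpevalC ltxx.
exists 1; first exact: ltr01.
have [i|M hM] := @fin_all_exists _ _ (fun i M => forall x, 1 <= `|x| ->
    `|mpeval (q i) x| < 1 ->
    `|mpeval (lead_form (q i)) x| * `|x| <= M * `|x| ^+ (msize (q i)).-1).
  case sq : (msize (q i)) => [|[|d]].
  - exists 0 => x _ _.
    move/eqP: sq; rewrite msize_poly_eq0 => /eqP->.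
    by rewrite /lead_form pihomog0 -mpolyC0 mpevalC normr0 !mul0r.
  - by case: nconst; exists i; rewrite sq.
  have [M M0 hM] := lead_form_approx sq.
  exists (1 + M) => x x1 qx /=; rewrite exprSr mulrA ler_pM2r; last lra.
  have hx := hM x x1; have xd : 1 <= `|x| ^+ d by rewrite exprn_ege1.
  rewrite mulrDl mul1r.
  rewrite -[mpeval (lead_form _) x](subKr (mpeval (q i) x)).
  apply: (le_trans (ler_normB _ _)); apply: lerD => //.
  by apply: ltW; apply: lt_le_trans qx xd.
pose Q : mpoly n R := \sum_i lead_form (q i) ^+ 2.
have QE x : mpeval Q x = \sum_i mpeval (lead_form (q i)) x ^+ 2.
  by rewrite mpeval_sum; apply: eq_bigr => i _; rewrite mpevalX.
pose S := [set u : 'rV[R]_n | `|u| = 1].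
have cS : compact S.
  apply: bounded_closed_compact.
    exists 1; split; first exact: num_real.
    by move=> r r1 x /= ->; exact: ltW.
  apply: (@preimage_closed _ _ (fun x : 'rV[R]_n => `|x|) [set r | r = 1]).
    by move=> x _; exact: norm_continuous.
  exact: closed_eq.
(* The sphere is empty in dimension 0. *)
have [S0|S0] := pselect (S !=set0); last first.
  exists 0 => x _; rewrite leNgt normr_gt0; apply/negP => x0; apply: S0.
  by exists (`|x|^-1 *: x); rewrite /S /= mx_normZ normfV normr_id mulVf ?normr_eq0.
have [|u uS umin] := EVT_min_rV S0 cS (f := mpeval Q).
  by apply: continuous_subspaceT => z; exact: mpeval_continuous.
have Qu : 0 < mpeval Q u.
  rewrite QE lt_neqAle sumr_ge0 ?andbT; last by move=> *; exact: sqr_ge0.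
  apply/negP; rewrite eq_sym psumr_eq0 => [/allP u0|*]; last exact: sqr_ge0.
  move: uS; rewrite inE /S /= (q0 u) ?normr0.
    by move/eqP; rewrite eq_sym oner_eq0.
  by move=> i; apply/eqP; rewrite -sqrf_eq0; apply: u0; rewrite mem_index_enum.
pose K := \sum_i M i ^+ 2.
exists (1 + K / mpeval Q u) => x qx.
have K0 : 0 <= K by apply: sumr_ge0 => *; exact: sqr_ge0.
have KQ : 0 <= K / mpeval Q u by rewrite divr_ge0 // ltW.
have [x1|x1] := leP `|x| 1; first lra.
have x0 : 0 < `|x| by lra.
suff : `|x| <= K / mpeval Q u by lra.
rewrite ler_pdivlMr //.
have Sx : S (`|x|^-1 *: x).
  by rewrite /S /= mx_normZ normfV normr_id mulVf // gt_eqF.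
have leadx i : mpeval (lead_form (q i)) (`|x|^-1 *: x) ^+ 2 * `|x| ^+ 2 <= M i ^+ 2.
  have := hM i x (ltW x1) (qx i).
  have -> : mpeval (lead_form (q i)) x = `|x| ^+ (msize (q i)).-1 *
      mpeval (lead_form (q i)) (`|x|^-1 *: x).
    by rewrite -mpeval_pihomogZ scalerA mulfV ?gt_eqF // scale1r.
  rewrite normrM normrX normr_id -mulrA mulrC ler_pM2r ?exprn_gt0 // => lex.
  rewrite -[X in X * _]real_normK ?num_real // -exprMn.
  by apply: lerXn2r => //; rewrite nnegrE; [|apply: le_trans lex]; rewrite mulr_ge0.
have := umin _ (mem_set Sx); rewrite [mpeval Q (_ *: _)]QE => Qux.
have : mpeval Q u * `|x| ^+ 2 <= K.
  apply: le_trans (_ : (\sum_i mpeval (lead_form (q i)) (`|x|^-1 *: x) ^+ 2)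
    * `|x| ^+ 2 <= _); first by rewrite ler_wpM2r // exprn_ge0.
  by rewrite mulr_suml; apply: ler_sum.
nra.
Qed.

(** A gradient bounded away from [0] outside a ball forces a nonnegative
    polynomial to tend to infinity.  The point [a] of a sublevel set is compared
    with a minimiser [w] of [q] plus a quadratic penalty centred at [a]; since
    [a] itself pays no penalty, [w] satisfies [eps * |w - a| ^ 2 <= C], while
    [grad q w = - 2 * eps * (w - a)]. *)
Lemma coercive_of_gradient q (delta B : R) : 0 < delta ->
    (forall x, 0 <= mpeval q x) ->
    (forall x, (forall i, `|mpeval (mderiv i q) x| < delta) -> `|x| <= B) ->
  forall C, exists B', forall x, mpeval q x <= C -> `|x| <= B'.
Proof.
move=> delta0 q0 gradq C.
(* The gradient at [w] then has squared components at most [4 * eps * |C|],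
   which this choice of [eps] keeps below [delta ^ 2]. *)
pose eps := delta ^+ 2 / (4 * (`|C| + 1)).
have C1 : 0 < `|C| + 1 by rewrite ltr_wpDl.
have epsC : 4 * eps * (`|C| + 1) = delta ^+ 2 by rewrite /eps; field; rewrite gt_eqF.
have eps0 : 0 < eps by rewrite /eps divr_gt0 ?exprn_gt0 ?mulr_gt0.
have CE : 0 <= `|C| / eps by rewrite divr_ge0 // ltW.
exists (B + (1 + `|C| / eps)) => a qaC.
have qaC' : mpeval q a <= `|C| by apply: le_trans qaC (ler_norm _).
pose g : mpoly n R := q + mpolyC n eps *
  \sum_j (mpolyX R (mnm1 j) - mpolyC n (a 0 j)) ^+ 2.
have gE z : mpeval g z = mpeval q z + eps * \sum_j (z 0 j - a 0 j) ^+ 2.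
  rewrite mpevalD mpevalM mpevalC mpeval_sum; congr (_ + _ * _).
  by apply: eq_bigr => j _; rewrite mpevalX mpevalB mpevalXU mpevalC.
have ga : mpeval g a = mpeval q a.
  by rewrite gE big1 ?mulr0 ?addr0 // => j _; rewrite subrr expr0n.
have penalty_le z : mpeval g z <= mpeval g a ->
    forall i, eps * (z 0 i - a 0 i) ^+ 2 <= `|C|.
  rewrite ga gE => gz i; have := q0 z.
  have : eps * (z 0 i - a 0 i) ^+ 2 <= eps * \sum_j (z 0 j - a 0 j) ^+ 2.
    rewrite ler_pM2l // (bigD1 i) //= lerDl.
    by apply: sumr_ge0 => *; exact: sqr_ge0.
  lra.
(* [t ^ 2 <= K] implies [t <= 1 + K], which avoids a square root. *)
have dist_le z : mpeval g z <= mpeval g a -> `|a - z| <= 1 + `|C| / eps.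
  move=> /penalty_le gz; apply: norm_le_coord; first lra.
  move=> i; rewrite !mxE distrC.
  have : (z 0 i - a 0 i) ^+ 2 <= `|C| / eps by rewrite ler_pdivlMr // mulrC.
  by rewrite -real_normK ?num_real //; nra.
have [|w wmin] := @mpeval_attains_min g a (`|a| + (1 + `|C| / eps)).
  move=> z gz; rewrite -[z](subKr a); apply: le_trans (ler_normB _ _) _.
  by rewrite lerD2l dist_le.
have wB : `|w| <= B.
  apply: gradq => i; have := critical_of_min i wmin.
  rewrite mderivD mderivM mderivC mul0r add0r mpevalD mpevalM mpevalC.
  rewrite mderiv_sum (bigD1 i) //= big1 => [|j ji]; last first.
    by rewrite mderiv_exp mderivB mderivC subr0 mderivXU (negPf ji) mulr0.
  rewrite addr0 mderiv_exp mderivB mderivC subr0 mderivXU eqxx mulr1 expr1.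
  rewrite mpevalM mpeval_nat mpevalB mpevalXU mpevalC => dw.
  have wi := penalty_le _ (wmin a) i.
  rewrite -(@ltr_pXn2r _ 2) ?nnegrE ?normr_ge0 ?(ltW delta0) //.
  rewrite real_normK ?num_real // -epsC.
  have -> : mpeval (mderiv i q) w ^+ 2 = 4 * eps * (eps * (w 0 i - a 0 i) ^+ 2).
    by move/eqP: dw; rewrite addr_eq0 => /eqP->; ring.
  by rewrite ltr_pM2l; lra.
rewrite -[a](subrK w); apply: le_trans (ler_normD _ _) _.
by rewrite addrC lerD ?dist_le.
Qed.

End RealPolynomials.

(** * Surjectivity *)

Theorem theorem1p9 (R : realType) (n : nat) (p : 'I_n -> mpoly n R)
    (hJ : forall x : 'rV[R]_n, mpeval (\det (jacobian_mx p)) x != 0)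
    (halpha : exists alpha : 'I_n -> nat,
      (forall j, (0 < alpha j)%N && ~~ odd (alpha j)) /\
      (forall x : 'rV[R]_n,
         (forall i : 'I_n,
            mpeval (lead_form (\sum_(j < n)
              (alpha j)%:R * p j ^+ (alpha j).-1 * mderiv i (p j))) x = 0) ->
         x = 0)) :
  polymap p @` [set: 'rV[R]_n] = [set: 'rV[R]_n].
Proof.
have [alpha [alphaP lead0]] := halpha.
pose g : mpoly n R := \sum_j p j ^+ alpha j.
have g0 x : 0 <= mpeval g x.
  rewrite mpeval_sum; apply: sumr_ge0 => j _; rewrite mpevalX.
  by apply: exprn_even_ge0; case/andP: (alphaP j).
have dg i : mderiv i g =
    \sum_(j < n) (alpha j)%:R * p j ^+ (alpha j).-1 * mderiv i (p j).
  by rewrite mderiv_sum; apply: eq_bigr => j _; exact: mderiv_exp.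
have [|delta delta0 [B hB]] :=
    @lead_forms_bounded_preimage R n n (fun i => mderiv i g).
  by move=> x hx; apply: lead0 => i; rewrite -dg.
have gco := coercive_of_gradient delta0 g0 hB.
apply/seteqP; split => // y _.
pose Q : mpoly n R := \sum_j (p j - mpolyC n (y 0 j)) ^+ 2.
have QE x : mpeval Q x = \sum_j (mpeval (p j) x - y 0 j) ^+ 2.
  by rewrite mpeval_sum; apply: eq_bigr => j _; rewrite mpevalX mpevalB mpevalC.
(* Where [Q <= Q 0], each [|p_j|] is at most [|y_j| + 1 + Q 0], so [g <= K]. *)
pose K := \sum_j (`|y 0 j| + (1 + mpeval Q 0)) ^+ alpha j.
have [B' hB'] := gco K.
have [|w wmin] := @mpeval_attains_min R n Q 0 B'.
  move=> x Qx; apply: hB'; rewrite mpeval_sum; apply: ler_sum => j _.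
  rewrite mpevalX; apply: (le_trans (ler_norm _)); rewrite normrX.
  have Qj : (mpeval (p j) x - y 0 j) ^+ 2 <= mpeval Q 0.
    apply: le_trans Qx; rewrite QE (bigD1 j) //= lerDl.
    by apply: sumr_ge0 => *; exact: sqr_ge0.
  apply: lerXn2r; rewrite ?nnegrE ?normr_ge0 //.
    by have := sqr_ge0 (mpeval (p j) x - y 0 j); have := normr_ge0 (y 0 j); lra.
  rewrite -[mpeval (p j) x](subrK (y 0 j)) addrC.
  apply: le_trans (ler_normD _ _) _; rewrite lerD2l.
  by move: Qj; rewrite -real_normK ?num_real //; nra.
exists w => //.
pose A := map_mx (meval (fun i => w 0 i)) (jacobian_mx p).
have Aunit : A \in unitmx.
  by rewrite unitmxE unitfE det_map_mx; exact: hJ.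
(* Up to a factor 2, the entries of this product are the partial derivatives of
   [Q] at [w]. *)
have Av : A *m (polymap p w - y)^T = 0.
  apply/matrixP => i k; rewrite ord1 !mxE.
  have := critical_of_min i wmin.
  rewrite mderiv_sum mpeval_sum => dQ; apply: (@mulfI _ (2 : R)).
    by rewrite pnatr_eq0.
  rewrite mulr0 -[RHS]dQ mulr_sumr; apply: eq_bigr => j _.
  rewrite mderiv_exp mderivB mderivC subr0 expr1 !mpevalM mpeval_nat mpevalB.
  rewrite mpevalC.
  by rewrite !mxE /mpeval; ring.
apply/subr0_eq/trmx_inj; rewrite trmx0.
by rewrite -[LHS](mulKmx Aunit) Av mulmx0.
Qed.
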